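(* Let $r\ge 2$ and $i\ge 0$ be integers. There is a constant $C_{r,i}$ depending only on $r$ and $i$ such that every $(d-1)$-dimensional simplicial complex $\Gamma$ with $n$ vertices and $\mathrm{gr}_1(\Gamma)>2r$ satisfies $$f_i(\Gamma)\le C_{r,i}\, d^{\,i-1/r-1/r^2-\cdots-1/r^i}\, n^{\,1+1/r+1/r^2+\cdots+1/r^i}.$$
   Context: A simplicial complex $\Gamma$ on a finite vertex set $V=V(\Gamma)$ is a family of subsets of $V$ (faces) closed under taking subsets; its dimension is $\max\{|F|:F\in\Gamma\}-1$; $f_i(\Gamma)$ is the number of faces with $i+1$ elements. For $W\subseteq V$, $\Gamma[W]=\{F\in\Gamma:F\subseteq W\}$; for a face $F$ (possibly empty), $\mathrm{lk}_\Gamma(F)=\{G\setminus F: F\subseteq G\in\Gamma\}$. Fix a field $\mathbf{k}$; $\tilde H_i(\cdot;\mathbf{k})$ is reduced simplicial homology. The $1$-girth is $\mathrm{gr}_{1}(\Gamma)=\min\{|W|: W\subseteq V(\Gamma),\ \tilde H_{1}(\mathrm{lk}_\Gamma(F)[W];\mathbf{k})\neq 0 \text{ for some face } F\in\Gamma \text{ (including } F=\emptyset)\}$, or $\infty$ if none exists. *)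

(* Defs.v *)
From HB Require Import structures.
From mathcomp Require Import all_boot all_order all_algebra.

Set Implicit Arguments.
Unset Strict Implicit.
Unset Printing Implicit Defensive.

Import GRing.Theory.

Definition is_simplicial_complex (T : finType) (G : {set {set T}}) : Prop :=
  forall F H : {set T}, F \in G -> H \subset F -> H \in G.

Definition vertices (T : finType) (G : {set {set T}}) : {set T} :=
  [set v | [set v] \in G].

Definition fnum (T : finType) (i : nat) (G : {set {set T}}) : nat :=
  #|[set F in G | #|F| == i.+1]|.

(* Gamma has dimension d-1: the maximal face cardinality is d. *)
Definition has_dim_pred (T : finType) (G : {set {set T}}) (d : nat) : Prop :=
  (exists2 F, F \in G & #|F| = d) /\ (forall F, F \in G -> #|F| <= d)%N.

Definition induced (T : finType) (G : {set {set T}}) (W : {set T}) : {set {set T}} :=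
  [set F in G | F \subset W].

Definition link (T : finType) (G : {set {set T}}) (F : {set T}) : {set {set T}} :=
  [set H :\: F | H in G & F \subset H].

Definition bsign (K : fieldType) (T : finType) (F : {set T}) (v : T) : K :=
  (GRing.exp (-1) #|[set u in F | (enum_rank u < enum_rank v)%N]|)%R.

(* Boundary matrix d_k : C_k -> C_{k-1} (row-vector convention), with rows and
   columns indexed by all subsets of T; rows are nonzero only for k-faces
   (faces with k+1 elements). *)
Definition bdmx (K : fieldType) (T : finType) (G : {set {set T}}) (k : nat)
  : 'M[K]_(#|{set T}|, #|{set T}|) :=
  \matrix_(i, j)
    (let F : {set T} := enum_val i in
     let H : {set T} := enum_val j in
     if [&& F \in G, #|F| == k.+1 & H \subset F] && (#|F :\: H| == 1%N)
     then (if [pick v in F :\: H] is Some v then bsign K F v else 0%R)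
     else 0%R).

(* The space of k-chains: span of the basis vectors indexed by k-faces. *)
Definition chainsmx (K : fieldType) (T : finType) (G : {set {set T}}) (k : nat)
  : 'M[K]_(#|{set T}|, #|{set T}|) :=
  \matrix_(i, j)
    (let F : {set T} := enum_val i in
     if (i == j) && (F \in G) && (#|F| == k.+1) then 1%R else 0%R).

Definition H1_nonzero (K : fieldType) (T : finType) (G : {set {set T}}) : Prop :=
  ~~ ((chainsmx K G 1 :&: kermx (bdmx K G 1)) <= bdmx K G 2)%MS.

(* gr_1(Gamma) > m, i.e. every W subset of V(Gamma) such that
   tilde H_1(lk_Gamma(F)[W]; K) <> 0 for some face F has more than m elements
   (vacuous if gr_1 = infinity). *)
Definition gr1_gt (K : fieldType) (T : finType) (G : {set {set T}}) (m : nat) : Prop :=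
  forall (W F : {set T}), W \subset vertices G -> F \in G ->
    H1_nonzero K (induced (link G F) W) -> (m < #|W|)%N.

From Stdlib Require Import Reals.
Local Open Scope R_scope.

Fixpoint geom_sum (r : nat) (i : nat) : R :=
  match i with
  | O => 0
  | S j => geom_sum r j + / (INR r ^ (S j))
  end.

(* Main.v *)
Require Import Defs.
From HB Require Import structures.
From mathcomp Require Import all_boot all_order all_algebra.
From mathcomp Require Import zify.

(* The girth condition, applied to links and to induced subcomplexes, says that the complex
   is the clique complex of its 1-skeleton and that in this graph every closed walk of
   length at most 2r has chords.  Hence the common neighbours of two non-adjacent vertices
   form a clique, and, inductively, two vertices are joined by O(d^(r-1)) induced walks of
   length r.  If all degrees are at least C(d + k), then after deleting the few arcs (x, v)
   for which x is adjacent to nearly all neighbours of v, every induced walk extends in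
   more than k ways, so that k^r = O(d^(r-1) n).  Thus every induced subgraph has a vertex
   of degree O(d^(1-1/r) n^(1/r)).  Removing such vertices one at a time and counting each
   clique in the neighbourhood of its first removed vertex raises i by one. *)

Set Implicit Arguments.
Unset Strict Implicit.
Unset Printing Implicit Defensive.

Import GRing.Theory.

(** * Homology of closed walks *)

Definition adj (T : finType) (D : {set {set T}}) : rel T :=
  fun x y => (x != y) && ([set x; y] \in D).

Lemma adj_sym (T : finType) (D : {set {set T}}) : symmetric (adj D).
Proof. by move=> x y; rewrite /adj eq_sym setUC. Qed.

Lemma adj_irr (T : finType) (D : {set {set T}}) : irreflexive (adj D).
Proof. by move=> x; rewrite /adj eqxx. Qed.

Section Homology.
Variables (K : fieldType) (T : finType).
Implicit Types (D : {set {set T}}) (x y a b : T) (S : {set T}) (p : seq T).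
Local Open Scope ring_scope.

Definition delta_row S : 'rV[K]_#|{set T}| := delta_mx 0 (enum_rank S).

(** The oriented edge from [x] to [y]: the sign makes its boundary [[set y]] minus [[set x]],
    whichever of the two has the smaller rank. *)
Definition edge_chain x y := bsign K [set x; y] x *: delta_row [set x; y].

Fixpoint walk_chain a p :=
  if p is b :: p' then edge_chain a b + walk_chain b p' else 0.

Lemma delta_row_chains D k S : S \in D -> #|S| = k.+1 ->
  (delta_row S <= chainsmx K D k)%MS.
Proof.
move=> SD cS; apply/submxP; exists (delta_row S).
rewrite /delta_row -rowE; apply/rowP=> j; rewrite !mxE /= enum_rankK SD cS !eqxx !andbT.
by rewrite eq_sym; case: (_ == _).
Qed.

(** The vertex of smaller rank has no predecessor in the pair and the other has exactly one, so the
    two signs are 1 and -1. *)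
Lemma bsign_pair x y : x != y -> bsign K [set x; y] y * bsign K [set x; y] x = -1.
Proof.
suff H (u v : T) : u != v -> (enum_rank u < enum_rank v)%N ->
    bsign K [set u; v] u = 1 /\ bsign K [set u; v] v = -1.
  move=> nxy; have [lt|lt|/val_inj/enum_rank_inj E] := ltngtP (enum_rank x) (enum_rank y).
  - by have [-> ->] := H _ _ nxy lt; rewrite mulr1.
  - by rewrite setUC; have [|-> ->] := H _ _ _ lt; rewrite 1?eq_sym //; rewrite mul1r.
  - by rewrite E eqxx in nxy.
move=> nuv lt; rewrite /bsign; split.
  rewrite (_ : [set w in _ | _] = set0) ?cards0 //.
  apply/setP=> w; rewrite !inE; apply/negP=> /andP[/orP[]/eqP->]; rewrite ?ltnn //.
  by rewrite ltnNge ltnW.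
rewrite (_ : [set w in _ | _] = [set u]) ?cards1 //.
apply/setP=> w; rewrite !inE; have [->|nwu] /= := eqVneq w u; first exact: lt.
by apply/negP=> /andP[/eqP->]; rewrite ltnn.
Qed.

Lemma boundary_edge D x y : adj D x y ->
  edge_chain x y *m bdmx K D 1 = delta_row [set y] - delta_row [set x].
Proof.
case/andP=> nxy xyD; rewrite /edge_chain -scalemxAl /delta_row -rowE.
apply/rowP=> j; rewrite !mxE /= enum_rankK xyD cards2 nxy /=.
have rk (S : {set T}) : (j == enum_rank S) = (enum_val j == S).
  by apply/eqP/eqP => [->|<-]; rewrite ?enum_rankK ?enum_valK.
rewrite !rk; set H := enum_val j.
have [Hy|nHy] := eqVneq H [set y].
  have -> : [set x; y] :\: H = [set x].
    apply/setP=> z; rewrite Hy !inE; have [->|] := eqVneq z y; last by rewrite orbF.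
    by rewrite eq_sym (negbTE nxy).
  rewrite Hy subsetUr cards1 /=.
  have -> : ([set y] == [set x]) = false.
    by apply/negbTE; apply: contraNneq nxy => E; rewrite -in_set1 E set11.
  case: pickP => [z|/(_ x)]; rewrite !inE ?eqxx // => /eqP->.
  by rewrite /bsign -expr2 sqrr_sign subr0.
have [Hx|nHx] := eqVneq H [set x].
  have -> : [set x; y] :\: H = [set y].
    apply/setP=> z; rewrite Hx !inE; have [->|] := eqVneq z x; last by [].
    by rewrite (negbTE nxy).
  rewrite Hx subsetUl cards1 /=.
  case: pickP => [z|/(_ y)]; rewrite !inE ?eqxx // => /eqP->.
  by rewrite mulrC bsign_pair // sub0r.
case: ifP => [/andP[sH c1]|_]; last by rewrite mulr0 subr0.
have cH : #|H| = 1%N.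
  by have := cardsID H [set x; y]; rewrite (setIidPr sH) (eqP c1) cards2 nxy /=; lia.
have /eqP/cards1P[z Hz] := cH.
move: sH; rewrite Hz sub1set !inE => /orP[]/eqP Ez.
  by rewrite Hz Ez eqxx in nHx.
by rewrite Hz Ez eqxx in nHy.
Qed.

Lemma boundary_walk D a p : path (adj D) a p ->
  walk_chain a p *m bdmx K D 1 = delta_row [set last a p] - delta_row [set a].
Proof.
elim: p a => [|b p IH] a /=; first by rewrite mul0mx subrr.
by case/andP=> ab pb; rewrite mulmxDl boundary_edge // IH // addrC addrA subrK.
Qed.

Lemma walk_chain_chains D a p : path (adj D) a p ->
  (walk_chain a p <= chainsmx K D 1)%MS.
Proof.
elim: p a => [|b p IH] a /=; first by rewrite sub0mx.
case/andP=> /andP[nab abD] pb; apply: addmx_sub; last exact: IH.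
by apply: scalemx_sub; apply: delta_row_chains; rewrite // cards2 nab.
Qed.

Lemma walk_chain_avoid x y a p : x \notin a :: p ->
  walk_chain a p 0 (enum_rank [set x; y]) = 0.
Proof.
elim: p a => [|b p IH] a; first by rewrite mxE.
rewrite inE negb_or => /andP[nxa nxp] /=; rewrite mxE IH // addr0 !mxE eqxx /=.
case: eqP; last by rewrite mulr0.
move/enum_rank_inj/setP/(_ x); rewrite !inE eqxx (negbTE nxa) /=.
by move: nxp; rewrite inE negb_or => /andP[/negbTE->].
Qed.

(* No boundary of a 2-chain involves the edge [set x; a], whereas the closed walk
   x, a, ..., b, x traverses it exactly once. *)
Lemma H1_nonzero_closed_walk D x a p :
  adj D x a -> path (adj D) a p -> adj D (last a p) x ->
  x \notin a :: p -> last a p != a ->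
  (forall S, S \in D -> #|S| = 3 -> ~~ ([set x; a] \subset S)) ->
  H1_nonzero K D.
Proof.
move=> xa pa bx xp nba no3.
set q := a :: rcons p x.
have pq : path (adj D) x q by rewrite /q /= xa rcons_path pa bx.
have lq : last x q = x by rewrite /q /= last_rcons.
apply/negP=> sub.
have : (walk_chain x q <= bdmx K D 2)%MS.
  apply: submx_trans sub; rewrite sub_capmx walk_chain_chains // andTb.
  by apply/sub_kermxP; rewrite boundary_walk // lq subrr.
case/submxP=> c /rowP/(_ (enum_rank [set x; a])).
rewrite [RHS]mxE big1 => [|i _]; last first.
  rewrite mxE /= enum_rankK; case: ifP => [/andP[/and3P[iD /eqP c3 s3]]|]; last by rewrite mulr0.
  by case/negP: (no3 _ iD c3).
have catE (u : T) s t : walk_chain u (s ++ t) = walk_chain u s + walk_chain (last u s) t.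
  by elim: s u => [|v s IH] u /=; rewrite ?add0r // IH addrA.
rewrite /q /= -cats1 catE /= addr0 !mxE walk_chain_avoid // !eqxx /= mulr1 add0r.
(* The closing edge could cancel the first one only if they coincide, which would make [last a p]
   equal to [a] or to [x]. *)
case: eqP => [/enum_rank_inj E|_]; last by move/eqP; rewrite mulr0 addr0 signr_eq0.
have := xp; rewrite inE negb_or => /andP[/negbTE nxa _].
have : last a p \in [set x; a] by rewrite E !inE eqxx.
rewrite !inE (negbTE nba) orbF => /eqP lx.
by have := xp; rewrite -lx mem_last.
Qed.

End Homology.

(** * Flag property of the complex and chords in its 1-skeleton *)

(* No induced cycle of length 4, ..., 2r, phrased for closed walks x, a, ..., b, x that need
   not be simple: only x must not be revisited. *)
Definition chordal_upto (T : finType) (r : nat) (e : rel T) := forall x a p,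
  e x a -> path e a p -> e x (last a p) -> a != last a p -> (size p).+2 <= 2 * r ->
  all (fun y => (y != x) && (e x y ==> (y \in [:: a; last a p]))) p -> e a (last a p).

Section Complex.
Variables (K : fieldType) (T : finType) (G : {set {set T}}) (r : nat).
Hypothesis G_complex : is_simplicial_complex G.
Hypothesis G_girth : gr1_gt K G (2 * r).

Lemma linkP (F H : {set T}) : H \in link G F -> F :|: H \in G /\ [disjoint F & H].
Proof.
case/imsetP=> S; rewrite inE => /andP[SG FS] ->; split.
  by rewrite setDE setUIr setUCr setIT (setUidPr FS).
by rewrite disjoints_subset setDE setCI setCK subsetUr.
Qed.

Lemma in_link (F H : {set T}) : F :|: H \in G -> [disjoint F & H] -> H \in link G F.
Proof.
move=> FHG dis; apply/imsetP; exists (F :|: H); first by rewrite inE FHG subsetUl.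
rewrite setDUl setDv set0U; apply/esym/setDidPl; by rewrite disjoint_sym.
Qed.

(** If no vertex of [p] completed the edge [x a] to a triangle, the closed walk would give nonzero
    homology to the link restricted to the vertices of the walk. There are at most [2 * r] of them,
    against the girth. *)
Lemma link_triangle (F : {set T}) (x a : T) (p : seq T) : F \in G ->
  adj (link G F) x a -> path (adj (link G F)) a p -> adj (link G F) (last a p) x ->
  x \notin a :: p -> last a p != a -> (size p).+2 <= 2 * r ->
  exists2 c, c \in p & (c != a) && ([set x; a; c] \in link G F).
Proof.
move=> FG xa pa bx xp nba sz.
pose W : {set T} := [set z in x :: a :: p].
have cW : #|W| <= 2 * r.
  by rewrite cardsE; apply: leq_trans (card_size (x :: a :: p)) _.
have adjW u v : u \in W -> v \in W -> adj (link G F) u v -> adj (induced (link G F) W) u v.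
  move=> uW vW /andP[nuv uv]; rewrite /adj nuv inE uv /=.
  by apply/subsetP=> z; rewrite in_set2 => /orP[]/eqP->.
have xW : x \in W by rewrite !inE eqxx.
have aW : a \in W by rewrite !inE eqxx orbT.
have pW z : z \in a :: p -> z \in W by rewrite !inE => ->; rewrite orbT.
have vert u v : adj (link G F) u v -> u \in vertices G.
  case/andP=> _ /linkP[uG _]; rewrite inE; apply: G_complex uG _.
  by rewrite sub1set !inE eqxx orbT.
have WV : W \subset vertices G.
  apply/subsetP=> z; rewrite /W in_set !in_cons => /or3P[/eqP->|/eqP->|zp].
  - exact: vert xa.
  - by rewrite adj_sym in xa; apply: vert xa.
  case/splitPr: zp pa => p1 p2; rewrite cat_path /= => /and3P[_ + _].
  by rewrite adj_sym; apply: vert.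
have [/existsP[c /andP[cp Hc]]|none] :=
    boolP [exists c, (c \in p) && ((c != a) && ([set x; a; c] \in link G F))].
  by exists c.
suff : H1_nonzero K (induced (link G F) W).
  by move/(G_girth WV FG); rewrite ltnNge cW.
apply: (@H1_nonzero_closed_walk K T _ x a p) => //.
- exact: adjW.
- apply: (sub_in_path (P := mem (a :: p))) pa; last by apply/allP.
  by move=> u v /pW uW /pW vW; apply: adjW.
- by apply: adjW => //; apply: pW; apply: mem_last.
move=> S; rewrite inE => /andP[SD SW] cS; apply/negP=> sS.
have nxa : x != a by case/andP: xa.
have : #|S :\: [set x; a]| == 1.
  by rewrite cardsDS // cS cards2 nxa.
case/cards1P=> c cE.
have : c \in S :\: [set x; a] by rewrite cE set11.
rewrite !inE negb_or => /andP[/andP[ncx nca] cSS].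
have cp : c \in p by have := subsetP SW _ cSS; rewrite !inE (negbTE ncx) (negbTE nca).
case/existsP: none; exists c; rewrite cp nca /=.
suff -> : [set x; a; c] = S by [].
by rewrite -(setID S [set x; a]) cE (setIidPr sS).
Qed.

Lemma link_set0 : link G set0 = G.
Proof.
apply/setP=> H; apply/idP/idP => [/linkP[]|HG]; first by rewrite set0U.
by apply: in_link; rewrite ?set0U // disjoints_subset sub0set.
Qed.

(** In the link of the empty face, [link_triangle] yields a triangle [x a c] with [c] in [p]. Since
    [c] is a neighbour of [x] other than [a], it must be [last a p]. *)
Lemma skeleton_chordal : chordal_upto r (adj G).
Proof.
move=> x a p xa pa xb nab sz hp.
have xp : x \notin a :: p.
  rewrite inE negb_or; case/andP: (xa) => -> _ /=.
  by apply/negP=> /(allP hp); rewrite eqxx.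
have G0 : set0 \in G by case/andP: xa => _ /G_complex; apply; apply: sub0set.
have := @link_triangle set0 x a p G0; rewrite link_set0; case=> //.
- by rewrite adj_sym.
- by rewrite eq_sym.
move=> c cp /andP[nca tri].
have ncx : c != x by case/andP: (allP hp _ cp).
have xc : adj G x c.
  rewrite /adj eq_sym ncx /=; apply: G_complex tri _.
  by apply/subsetP=> z; rewrite !inE => /orP[]->; rewrite ?orbT.
have ac : adj G a c.
  rewrite /adj eq_sym nca /=; apply: G_complex tri _.
  by apply/subsetP=> z; rewrite !inE => /orP[]->; rewrite ?orbT.
have := allP hp _ cp; rewrite xc !inE (negbTE nca) /= => /andP[_ /eqP cE].
by rewrite -cE.
Qed.

(** Strong induction on the size of [S]. For three vertices [a], [b], [c] of [S] and [F] the rest,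
    the proper subsets of [S] are faces, so [a, b, c] is a closed walk in the link of [F];
    [link_triangle] fills it, which makes [S] a face. *)
Lemma skeleton_flag (S : {set T}) : 2 <= r -> set0 \in G -> S \subset vertices G ->
  {in S &, forall x y, x != y -> adj G x y} -> S \in G.
Proof.
move=> r2 G0; have [n le] := ubnP #|S|; elim: n => // n IH in S le *.
move=> SV cl; have sub (S' : {set T}) : S' \proper S -> S' \in G.
  move=> pS; apply: IH.
  - exact: leq_trans (proper_card pS) _.
  - exact: subset_trans (proper_sub pS) SV.
  by move=> x y xS yS; apply: cl; apply: (subsetP (proper_sub pS)).
have [->//|[a aS]] := set_0Vmem S.
have [S1|[b]] := set_0Vmem (S :\ a).
  move: (setD1K aS); rewrite S1 setU0 => <-.
  by have := subsetP SV _ aS; rewrite inE.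
rewrite !inE => /andP[nba bS].
have [S2|[c]] := set_0Vmem (S :\: [set a; b]).
  have <- : [set a; b] = S.
    rewrite -(setID S [set a; b]) S2 setU0; apply/esym/setIidPr.
    by apply/subsetP=> z; rewrite !inE => /orP[]/eqP->.
  by have /andP[_] : adj G a b by apply: cl => //; rewrite eq_sym.
rewrite !inE negb_or => /andP[/andP[nca ncb] cS].
pose F := S :\: [set a; b; c].
have FS : F \proper S.
  by apply/properP; split; [apply: subsetDl | exists a; rewrite // !inE eqxx].
have link2 u v w : u \in S -> v \in S -> w \in S -> u != v -> u != w -> v != w ->
    [set a; b; c] = [set u; v; w] -> adj (link G F) u v.
  move=> uS vS wS nuv nuw nvw E; rewrite /adj nuv /=; apply: in_link.
    apply: sub; apply/properP; split.
      rewrite subUset subsetDl; apply/subsetP=> z.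
      by rewrite in_set2 => /orP[]/eqP->.
    exists w => //; rewrite /F E !inE eqxx !orbT /=.
    by rewrite negb_or ![w == _]eq_sym nuw.
  rewrite disjoints_subset; apply/subsetP=> z; rewrite /F E !inE !negb_or.
  by case/andP=> /andP[/andP[-> ->]].
have nab : a != b by rewrite eq_sym.
have nac : a != c by rewrite eq_sym.
have nbc : b != c by rewrite eq_sym.
have := @link_triangle F a b [:: c] (sub _ FS); case=> //=.
- exact: (link2 _ _ c).
- rewrite andbT; apply: (link2 _ _ a) => //.
  by apply/setP=> z; rewrite !inE; do 3!case: (_ == _).
- apply: (link2 _ _ b) => //.
  by apply/setP=> z; rewrite !inE; do 3!case: (_ == _).
- by rewrite !inE negb_or nab.
- exact: leq_trans (leq_mul (leqnn 2) r2).
move=> z; rewrite inE => /eqP-> /andP[_] /linkP[SG _].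
suff <- : F :|: [set a; b; c] = S by [].
rewrite setUC -{1}(@setIidPr _ S [set a; b; c] _) ?setID //.
by apply/subsetP=> y; rewrite !inE => /orP[/orP[]|]/eqP->.
Qed.

End Complex.

(** * Counting by duplicate-free lists *)

(** Walks are lists of vertices, an infinite type, so cardinalities are bounded through
    duplicate-free lists of elements satisfying [P]. *)
Definition atmost (A : eqType) (P : A -> Prop) (n : nat) :=
  forall L : seq A, uniq L -> {in L, forall x, P x} -> size L <= n.

Section AtMost.
Variables (A B : eqType).
Implicit Types (P Q : A -> Prop) (R : B -> Prop) (f : A -> B).

Lemma atmost_sub P Q m n : (forall x, Q x -> P x) -> m <= n -> atmost P m -> atmost Q n.
Proof. by move=> QP le H L uL HL; apply: leq_trans le; apply: H uL _ => x /HL/QP. Qed.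

(** Only the empty list qualifies when [P] has no witness; this allows a reference walk to be fixed
    before counting. *)
Lemma atmost_witness P n : (forall x, P x -> atmost P n) -> atmost P n.
Proof. by move=> H [|x L] // uL HL; apply: (H x) (HL) => //; apply: HL; apply: mem_head. Qed.

Lemma atmost_split (t : pred A) P m n : atmost (fun x => P x /\ t x) m ->
  atmost (fun x => P x /\ ~~ t x) n -> atmost P (m + n).
Proof.
move=> Hm Hn L uL HL; rewrite -(count_predC t) -!size_filter.
apply: leq_add; [apply: Hm | apply: Hn]; rewrite ?filter_uniq // => x;
  by rewrite mem_filter => /andP[? /HL].
Qed.

Lemma atmost_inj f P R n : (forall x y, P x -> P y -> f x = f y -> x = y) ->
  (forall x, P x -> R (f x)) -> atmost R n -> atmost P n.
Proof.
move=> inj PR H L uL HL; rewrite -(size_map f); apply: H.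
  by rewrite map_inj_in_uniq // => x y /HL Px /HL Py; apply: inj.
by move=> _ /mapP[x /HL/PR ? ->].
Qed.

Lemma atmost_fiber f P m n : atmost (fun y => exists2 x, P x & f x = y) m ->
  (forall x, P x -> atmost (fun z => P z /\ f z = f x) n) -> atmost P (m * n).
Proof.
move=> Hm Hn L uL HL; set M := undup (map f L).
have sM : size M <= m.
  apply: Hm; first exact: undup_uniq.
  by move=> y; rewrite mem_undup => /mapP[x /HL Px ->]; exists x.
suff : size L <= size M * n by move/leq_trans; apply; rewrite leq_mul2r sM orbT.
have -> : size L = \sum_(y <- M) count (fun x => f x == y) L.
  under eq_bigr => y _ do rewrite -sum1_count big_mkcond.
  rewrite exchange_big -sum1_size /= big_seq [RHS]big_seq; apply: eq_bigr => x xL.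
  rewrite -big_mkcond (eq_bigl (pred1 (f x))) => [|y]; last by rewrite /= eq_sym.
  by rewrite sum1_count count_uniq_mem ?undup_uniq // mem_undup map_f.
have -> : size M * n = \sum_(y <- M) n.
  by rewrite big_const_seq count_predT iter_addn_0 mulnC.
rewrite big_seq [leqRHS]big_seq; apply: leq_sum => y.
rewrite mem_undup => /mapP[x /HL Px ->]; rewrite -size_filter.
apply: (Hn x Px); first exact: filter_uniq.
by move=> z; rewrite mem_filter => /andP[/eqP-> /HL].
Qed.

End AtMost.

Lemma atmost_finset (T : finType) (S : {set T}) : atmost (fun x => x \in S) #|S|.
Proof. by move=> L uL HL; rewrite cardE; apply: uniq_leq_size => // x /HL; rewrite mem_enum. Qed.

(** * Induced walks *)

Definition clique (T : finType) (e : rel T) (S : {set T}) :=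
  {in S &, forall x y, x != y -> e x y}.

Section Graph.
Variables (T : finType) (e : rel T) (r d : nat).
Hypotheses (e_sym : symmetric e) (e_irr : irreflexive e).
Hypothesis r_ge2 : 2 <= r.
Hypothesis e_chordal : chordal_upto r e.
Hypothesis e_clique : forall S : {set T}, clique e S -> #|S| <= d.
Implicit Types (x y u v w : T) (s p q : seq T).

Definition apart x y := (x != y) && ~~ e x y.

(** Common neighbours [a] and [b] close the walk [x, a, y, b] of length 4. As [y] is not adjacent to
    [x], chordality joins [a] to [b], so the common neighbours form a clique. *)
Lemma common_neighbours x y : apart x y -> #|[set z | e x z && e y z]| <= d.
Proof.
case/andP=> nxy exy; apply: e_clique => a b; rewrite !inE => /andP[xa ya] /andP[xb yb] nab.
apply: (e_chordal (x := x) (p := [:: y; b])) => //=; rewrite ?(e_sym a) ?ya ?yb //.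
- exact: leq_mul (leqnn 2) r_ge2.
rewrite [y == x]eq_sym nxy (negbTE exy) !inE eqxx orbT implybT !andbT /=.
by apply: contraTneq xb => ->; rewrite e_irr.
Qed.

Fixpoint ind_walk u s :=
  if s is v :: s' then [&& e u v, all (apart u) s' & ind_walk v s'] else true.

Lemma ind_walk_path u s : ind_walk u s -> path e u s.
Proof. by elim: s u => //= v s IH u /and3P[-> _ /IH]. Qed.

Lemma ind_walk_rcons u s z :
  ind_walk u (rcons s z) = [&& ind_walk u s, e (last u s) z & all (apart^~ z) (belast u s)].
Proof.
elim: s u => [|v s IH] u /=; first by rewrite andbT.
rewrite all_rcons IH.
by case: (e u v); case: (apart u z); case: (all _ s) => //=; rewrite !andbF.
Qed.

Lemma ind_walk_take_drop n u s :
  ind_walk u s -> ind_walk u (take n s) /\ ind_walk (last u (take n s)) (drop n s).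
Proof.
rewrite -{1}(cat_take_drop n s); elim: (take n s) u => //= v t IH u.
by case/and3P=> -> + /IH[-> ->]; rewrite all_cat => /andP[-> _].
Qed.

(** Induction on the far end: if [x] were adjacent to the new last vertex [w], it would see only [y]
    and [w] on the closed walk, so [y] and [w] would be adjacent, although the walk from [y] is
    induced. *)
Lemma ind_walk_extend x y z s : e x y -> ind_walk y (z :: s) -> apart x z ->
  (size s).+3 <= 2 * r -> all (apart x) (z :: s).
Proof.
move=> xy + xz; elim/last_ind: s => [|s w IH]; first by rewrite /= xz.
rewrite -rcons_cons ind_walk_rcons size_rcons all_rcons => /and3P[H1 H2 H3] sz.
have A := IH H1 (ltnW sz); rewrite A andbT.
have lA : apart x (last y (z :: s)) by move/allP: (A) => /(_ _ (mem_last z s)).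
have yw : apart y w by move: H3 => /= /andP[].
have nwx : x != w by apply: contraTneq H2 => <-; rewrite e_sym; case/andP: lA.
rewrite /apart nwx /=; apply/negP=> xw.
case/andP: (yw) => nyw /negP; apply.
have := e_chordal (x := x) (a := y) (p := rcons (z :: s) w).
rewrite last_rcons size_rcons; apply=> //.
  by rewrite rcons_path H2 andbT ind_walk_path.
rewrite all_rcons eq_sym nwx !inE eqxx orbT implybT andTb.
apply/allP=> c /(allP A)/andP[nxc /negbTE->].
by rewrite eq_sym nxc.
Qed.

(** A vertex of [t] equal to [x] would have its predecessor, a member of [belast u t], adjacent to
    [x]. *)
Lemma walk_away_neq x u t : path e u t -> all (predC (e x)) (belast u t) ->
  {in t, forall y, y != x}.
Proof.
elim: t u => //= v t IH u /andP[uv pt] /andP[n1 n2] y.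
rewrite inE => /orP[/eqP->|]; last exact: IH n2 y.
by apply: contraNneq n1 => <-; rewrite e_sym.
Qed.

(** The two walks from [u] to [w] have equal length. If [p2] is adjacent to [y], it sees only [p1]
    and [y] on the closed walk [p2, p1, u, q, y], so these are adjacent. Otherwise continue to [w]
    and back along [p3]: now [p2] sees only [p1] and the head of [p3], whose adjacency would
    contradict that the first walk is induced. *)
Lemma chord_p1 u (p1 p2 : T) (p3 : seq T) q y w :
  ind_walk u [:: p1, p2 & p3] -> w = last p2 p3 -> p3 != [::] ->
  ind_walk u (rcons (rcons q y) w) -> size q = size p3 -> (size q).+2 <= r ->
  all (predC (e p2)) q -> e p1 y.
Proof.
move=> Hp Ew np3 Hq sq szr /allP Aq.
have q_gt0 : 0 < size q by rewrite sq; case: p3 np3 {Hp Ew sq}.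
move: (Hp) => /= /and3P[up1 /andP[up2 Au] /and3P[p12 A1 Hp2]].
have pq : path e u (rcons (rcons q y) w) by apply: ind_walk_path.
have nup2 : ~~ e p2 u by rewrite e_sym; case/andP: up2.
have Bq : all (predC (e p2)) (u :: q).
  by rewrite /= nup2; apply/allP.
have nqy c : c \in rcons q y -> c != p2.
  apply: (@walk_away_neq _ u); last by rewrite belast_rcons.
  by move: pq; rewrite rcons_path => /andP[].
have uNp2 : u != p2 by case/andP: up2.
have uy : apart u y.
  move: Hq; rewrite ind_walk_rcons => /and3P[+ _ _].
  by case: (q) q_gt0 => // c q' _ /=; rewrite all_rcons => /and3P[_ /andP[->]].
have p1y : p1 != y by apply: contraTneq up1 => ->; case/andP: uy.
have midE c : c \in u :: q -> (c != p2) && ~~ e p2 c.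
  move=> cq; have /= -> := allP Bq _ cq; rewrite andbT.
  by move: cq; rewrite inE => /orP[/eqP->//|cq]; apply: nqy; rewrite mem_rcons inE cq orbT.
have [p2y|np2y] := boolP (e p2 y).
  have := e_chordal (x := p2) (a := p1) (p := u :: rcons q y).
  rewrite [last _ _]/= last_rcons; apply => //.
  - by rewrite e_sym.
  - by rewrite /= e_sym up1 /=; move: pq; rewrite rcons_path => /andP[].
  - by rewrite /= size_rcons; clear -szr r_ge2; lia.
  rewrite -rcons_cons all_rcons nqy ?mem_rcons ?mem_head //.
  rewrite !inE eqxx orbT implybT !andTb.
  by apply/allP=> c /midE/andP[-> /negbTE->].
case: p3 => [//|p3 s] in Hp Ew np3 sq szr Au A1 Hp2 *.
move: Hp2 A1 Ew => /= /and3P[p23 As _] /andP[p13 _] Ew.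
have bs : path e w (rev (belast p3 s)).
  rewrite Ew rev_path.
  have /ind_walk_path/= /and4P[_ _ _] := Hp.
  by apply: sub_path => a b; rewrite e_sym.
have lbs : last w (rev (belast p3 s)) = p3.
  by rewrite Ew; case: (s) => //= b s'; rewrite rev_cons last_rcons.
have := e_chordal (x := p2) (a := p1) (p := u :: rcons (rcons q y) w ++ rev (belast p3 s)).
rewrite [last _ _]/= last_cat last_rcons lbs => H.
case/andP: p13 => n13 /negP[]; apply: H => //.
- by rewrite e_sym.
- by rewrite /= e_sym up1 cat_path last_rcons bs pq.
(* Two walks of length at most [r] with the same ends close up to length at most [2 * r], exactly
   what [e_chordal] allows. *)
- by rewrite /= size_cat !size_rcons size_rev size_belast; move: sq => /=; clear -szr; lia.
have good c : c \in p3 :: s -> (c != p2) && (e p2 c ==> (c \in [:: p1; p3])).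
  rewrite inE => /orP[/eqP->|/(allP As)].
    by rewrite !inE eqxx orbT implybT andbT; apply: contraTneq p23 => ->; rewrite e_irr.
  by rewrite /apart eq_sym => /andP[-> /negbTE->].
have Aw : (w != p2) && (e p2 w ==> (w \in [:: p1; p3])).
  by apply: good; rewrite Ew mem_last.
rewrite -cat_cons all_cat -!rcons_cons !all_rcons Aw /=.
rewrite nqy ?mem_rcons ?mem_head // (negbTE np2y) /= uNp2 (negbTE nup2) /=.
apply/andP; split.
  by apply/allP=> c cq; have /andP[-> /negbTE->] := midE c (mem_behead (s := u :: q) cq).
rewrite all_rev; apply/allP=> c cs; apply: good.
exact: mem_belast cs.
Qed.

Definition ind_between u w j s := [/\ ind_walk u s, last u s = w & size s = j].

(** Dictated by the recursion in [ind_between_bound]: fewer than [m' + 2] terms, each at most a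
    product of two bounds for shorter walks. *)
Fixpoint walk_const m := if m is m'.+1 then (m' + 2) * walk_const m' ^ 2 else 1.

Lemma walk_const_gt0 m : 0 < walk_const m.
Proof. by elim: m => //= m IH; rewrite muln_gt0 addn2 /= expn_gt0 IH. Qed.

Lemma walk_const_mono m : walk_const m <= walk_const m.+1.
Proof. by have := walk_const_gt0 m; rewrite /= -mulnn; nia. Qed.

Lemma ind_between1 u w : atmost (ind_between u w 1) 1.
Proof.
move=> L uL HL; have : {subset L <= [:: [:: w]]}.
  by move=> s /HL[_ + /eqP]; case: s => [|v []] //= -> _; rewrite inE.
by move/(uniq_leq_size uL).
Qed.

(** The middle vertex determines the walk and is a common neighbour of the ends, which are apart
    because the walk is induced. *)
Lemma ind_between2 u w : atmost (ind_between u w 2) d.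
Proof.
move=> L uL HL; case EL : L => [//|s0 L0]; rewrite -EL.
have uw : apart u w.
  have [] := HL s0; first by rewrite EL mem_head.
  by case: s0 {EL} => [|a [|b []]] //= /and3P[_ /andP[+ _] _] <-.
apply: leq_trans (common_neighbours uw).
pose f s := head u s; rewrite -(size_map f) cardE; apply: uniq_leq_size.
  rewrite map_inj_in_uniq // => s t /HL[_ + +] /HL[_ + +]; rewrite /f.
  by case: s => [|a [|b []]] //= <- _; case: t => [|a' [|b' []]] //= -> _ ->.
move=> _ /mapP[s /HL[+ + +] ->]; rewrite /f mem_enum inE.
by case: s => [|a [|b []]] //=; rewrite !andbT => /and3P[-> _ ab] <- _; rewrite e_sym.
Qed.

(* Fix one walk u, p1, p2, ..., w.  In any other walk u = q_0, ..., q_j = w either the first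
   neighbour q_t of p2 has t <= j - 2, and then q_0, ..., q_t, p2 and q_t, ..., w are shorter
   induced walks, or q_(j-1) is one of the at most d common neighbours of p1 and w. *)
Lemma ind_between_bound m j u w : 0 < j -> j <= m -> m <= r ->
  atmost (ind_between u w j) (walk_const m * d ^ j.-1).
Proof.
elim: m j u w => [|m IH] j u w j0 jm mr; first by clear -j0 jm; lia.
have [jm'|mj] := leqP j m.
  apply: atmost_sub (IH j u w j0 jm' (ltnW mr)) => //.
  by rewrite leq_mul2r walk_const_mono orbT.
have {j0 jm mj}-> : j = m.+1 by clear -jm mj; lia.
case: m => [|[|m]] in IH mr *.
- by apply: atmost_sub (@ind_between1 u w) => //; rewrite muln_gt0 walk_const_gt0.
- apply: atmost_sub (@ind_between2 u w) => //; rewrite expn1 -{1}[d]mul1n leq_mul2r walk_const_gt0.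
  by rewrite orbT.
apply: atmost_witness => p0 [Hp lp sp].
case: p0 => [//|p1 [//|p2 p3]] in Hp lp sp *.
set c := walk_const m.+2 in IH *.
have -> : walk_const m.+3 = (m.+2 + 2) * c ^ 2 by [].
apply: (@atmost_sub _ (ind_between u w m.+3) _
  (m.+1 * (c ^ 2 * d ^ m.+2) + c ^ 2 * d ^ m.+2)) => //.
  by rewrite -mulSnr mulnA leq_mul2r leq_mul2r; apply/orP; right; apply/orP; right; clear; lia.
have sp3 : size p3 = m.+1 by case: sp.
move: (Hp) => /= /and3P[up1 /andP[up2 _] /and3P[p12 /allP p1A _]].
apply: (atmost_split (t := fun s => has (e p2) (take m.+1 s))).
  apply: (atmost_fiber (f := find (e p2))) => [L uL HL|s [[Hs ls ss] hs]].
    rewrite -(size_iota 0 m.+1); apply: uniq_leq_size => // i /HL[s [[_ _ ss] hs] <-].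
    by rewrite mem_iota /= add0n -has_take_leq // ss; clear; lia.
  set t := find (e p2) s.
  have tm : t <= m by rewrite -ltnS /t -has_take_leq // ss; clear; lia.
  (* [find] counts from 0 and [s] omits [u], so the head closed by [p2] has length [t + 2] and the
     tail has length [m + 2 - t]; each contributes one power of [d] less than its length. *)
  have -> : c ^ 2 * d ^ m.+2 = (c * d ^ t.+1) * (c * d ^ (m.+1 - t)).
    by rewrite mulnACA mulnn -expnD; congr (_ * _ ^ _); clear -tm; lia.
  apply: (atmost_fiber (f := take t.+1)).
    apply: (@atmost_inj _ _ (rcons^~ p2) _ (ind_between u p2 t.+2));
      last by apply: IH; clear -tm mr; lia.
      by move=> x y _ _ /rcons_inj[].
    move=> _ [z [[[Hz lz sz] hz] ft] <-].
    have tz : t < size z by rewrite sz; clear -tm; lia.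
    have hz' : has (e p2) z by rewrite has_find ft.
    have [Hz1 _] := ind_walk_take_drop t.+1 Hz.
    split; rewrite ?last_rcons ?size_rcons ?size_takel //.
    have away : all (predC (e p2)) (u :: take t z).
      rewrite /= [e p2 u]e_sym; case/andP: up2 => _ -> /=.
      by rewrite all_predC -ft has_take // ltnn.
    rewrite ind_walk_rcons Hz1 (take_nth u tz) last_rcons e_sym -{1}ft nth_find //.
    rewrite belast_rcons; apply/allP=> y yt; rewrite /apart [e y p2]e_sym.
    rewrite (allP away _ yt : ~~ e p2 y) andbT.
    move: yt; rewrite inE => /orP[/eqP->|yt]; first by case/andP: up2.
    apply: (@walk_away_neq _ u (take t.+1 z)); first exact: ind_walk_path.
      by rewrite (take_nth u tz) belast_rcons.
    by rewrite (take_nth u tz) mem_rcons inE yt orbT.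
  move=> z [[[Hz lz sz] hz] ft].
  apply: (@atmost_inj _ _ (drop t.+1) _ (ind_between (last u (take t.+1 z)) w (m.+2 - t))).
  - by move=> x y [_ Ex] [_ Ey] E; rewrite -(cat_take_drop t.+1 x) -(cat_take_drop t.+1 y) Ex Ey E.
  - move=> x [[[[Hx lx sx] _] _] Ex].
    have [_ Hx2] := ind_walk_take_drop t.+1 Hx.
    split; rewrite -?Ex //; first by rewrite -last_cat cat_take_drop.
    by rewrite size_drop sx; clear -tm; lia.
  have -> : m.+1 - t = (m.+2 - t).-1 by clear -tm; lia.
  by apply: IH; clear -tm mr; lia.
have dec s : ind_between u w m.+3 s -> s = rcons (rcons (take m.+1 s) (nth u s m.+1)) w.
  case=> _ ls ss; have <- : nth u s m.+2 = w by rewrite -ls (last_nth u) ss.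
  by rewrite -!take_nth ?ss // take_oversize // ss.
have p1w : apart p1 w.
  by move: lp => /= <-; apply: p1A; case: (p3) sp => // a s _; exact: (mem_last a s).
apply: (@atmost_sub _ (fun s => ind_between u w m.+3 s /\ ~~ has (e p2) (take m.+1 s)) _
  (d * (c * d ^ m.+1))) => //.
  by rewrite mulnCA -expnS leq_mul2r -mulnn leq_pmulr ?orbT // walk_const_gt0.
apply: (atmost_fiber (f := fun s => nth u s m.+1)).
  apply: atmost_sub (common_neighbours p1w) (@atmost_finset _ _) => //.
  move=> y [s [Bs]]; have [Hs _ ss] := Bs; rewrite -all_predC => As Ey.
  move: Hs; rewrite (dec s Bs) Ey => Hs; rewrite inE; apply/andP; split.
    apply: (chord_p1 Hp _ _ Hs) => //.
    - by rewrite -size_eq0 sp3.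
    - by rewrite sp3 size_takel ?ss // ltnW.
    - by rewrite size_takel ?ss // ltnW.
  by move: Hs; rewrite ind_walk_rcons last_rcons e_sym => /and3P[].
move=> s [Bs As].
apply: (@atmost_inj _ _ (take m.+2) _ (ind_between u (nth u s m.+1) m.+2));
  last by apply: IH => //; apply: ltnW.
  move=> x y [[Bx _] _] [[By _] _]; have [_ _ sx] := Bx; have [_ _ sy] := By.
  by move=> E; rewrite (dec x Bx) (dec y By) -!take_nth ?sx ?sy // E.
move=> x [[Bx _] Ex]; have [Hx _ sx] := Bx.
have {Hx}[Hx _] := ind_walk_take_drop m.+2 Hx.
split; first exact: Hx.
  by rewrite -Ex (@take_nth _ u) ?sx // last_rcons.
by rewrite size_takel ?sx.
Qed.

(** * Lower bound on the number of induced walks *)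

Section Cleaning.
Variables (A : {set T}) (k : nat).
Hypothesis e_A : forall x y, e x y -> x \in A.
Implicit Types E X : {set T * T}.

Definition nbrs E v := [set y | (v, y) \in E].
Definition far_nbrs E x v := [set y in nbrs E v | apart x y].
Definition isolated E := [set v in A | nbrs E v == set0].

(* X collects the deleted arcs (x, v) for which almost all remaining neighbours of v
   were adjacent to x; the clique condition keeps X small. *)
Definition cleaning_state E X : Prop :=
  [/\ forall x y, (x, y) \in E -> ((y, x) \in E) && e x y,
      forall x v, (x, v) \in X -> e x v && ((x, v) \notin E),
      forall x v, (x, v) \in X -> #|far_nbrs E x v| <= k,
      forall x y v, (x, v) \in X -> (y, v) \in X -> x != y -> e x y &
      #|[set p | e p.1 p.2]| <= #|E| + 2 * #|X| + 2 * (2 * k + d + 1) * #|isolated E|].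

Lemma card_snd_fiber E v : #|[set p in E | p.1 == v]| = #|nbrs E v|.
Proof.
have inj : injective (pair v : T -> T * T) by move=> y z [].
rewrite -(card_imset _ inj); apply: eq_card => -[a b]; rewrite !inE /=.
apply/andP/imsetP => [[abE /eqP Ea]|[y]]; last by rewrite inE => ? [-> ->].
by exists b; rewrite ?inE -?Ea.
Qed.

Lemma card_fst_fiber E v : (forall x y, (x, y) \in E -> (y, x) \in E) ->
  #|[set p in E | p.2 == v]| = #|nbrs E v|.
Proof.
move=> symE; have inj : injective (pair^~ v : T -> T * T) by move=> y z [].
rewrite -(card_imset _ inj); apply: eq_card => -[a b]; rewrite !inE /=.
apply/andP/imsetP => [[abE /eqP Eb]|[y]]; last by rewrite inE => /symE ? [-> ->].
by exists a; rewrite ?inE -?Eb // symE.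
Qed.

Lemma nbrs_sub E E' v : E' \subset E -> nbrs E' v \subset nbrs E v.
Proof. by move=> sE; apply/subsetP=> y; rewrite !inE; apply: (subsetP sE). Qed.

Lemma far_nbrs_sub E E' x v : E' \subset E -> far_nbrs E' x v \subset far_nbrs E x v.
Proof.
move=> sE; apply/subsetP=> y; rewrite !inE => /andP[yE ->]; rewrite andbT.
exact: (subsetP sE).
Qed.

Lemma isolated_sub E E' : E' \subset E -> isolated E \subset isolated E'.
Proof.
move=> sE; apply/subsetP=> v; rewrite !inE => /andP[-> /eqP N0] /=.
by rewrite -subset0 -N0 nbrs_sub.
Qed.

(** Deleting all arcs at [v] loses at most [2 * (2 * k + d + 1)] of them and makes [v] newly
    isolated, so the last inequality of the state is preserved. *)
Lemma remove_vertex E X v : cleaning_state E X -> nbrs E v != set0 ->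
  #|nbrs E v| <= 2 * k + d + 1 ->
  exists2 E', cleaning_state E' X & #|E'| < #|E|.
Proof.
case=> symE XE Xk Xcl cnt Nv Dv.
pose E' := [set p in E | (p.1 != v) && (p.2 != v)].
have sE : E' \subset E by apply/subsetP=> p; rewrite inE => /andP[].
have cE : #|E| <= #|E'| + 2 * #|nbrs E v|.
  have : E \subset E' :|: [set p in E | p.1 == v] :|: [set p in E | p.2 == v].
    by apply/subsetP=> p pE; rewrite !inE pE; case: (_ == v); case: (_ == v).
  move/subset_leq_card => /leq_trans; apply; apply: leq_trans (leq_card_setU _ _) _.
  rewrite mul2n -addnn addnA card_fst_fiber; last by move=> x y /symE/andP[].
  by rewrite leq_add2r -card_snd_fiber leq_card_setU.
have [y vy] := set0Pn _ Nv; rewrite inE in vy.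
exists E'; last first.
  apply: proper_card; apply/properP; split=> //.
  by exists (v, y); rewrite // inE eqxx andbF.
split=> //.
- by move=> a b; rewrite !inE /= => /and3P[/symE/andP[-> ->] -> ->].
- move=> a b /XE/andP[-> nab] /=; by apply: contra nab => /(subsetP sE).
- by move=> a b /Xk; apply: leq_trans; apply: subset_leq_card; apply: far_nbrs_sub.
have lt : #|isolated E| < #|isolated E'|.
  apply: proper_card; apply/properP; split; first exact: isolated_sub.
  exists v; last by rewrite inE (negbTE Nv) andbF.
  rewrite inE; have /symE/andP[_ /e_A->] := vy => /=.
  by apply/eqP/setP=> z; rewrite !inE /= eqxx /= andbF.
apply: leq_trans cnt _; move: cE Dv lt.
move: #|E| #|E'| #|X| #|nbrs E v| #|isolated E| #|isolated E'| (2 * k + d + 1).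
by clear; move=> *; nia.
Qed.

(** The arc is deleted with its reverse and recorded in [X]: two arcs lost, paid for by the term
    [2 * #|X|]. *)
Lemma remove_arc E X x v : cleaning_state E X -> (x, v) \in E ->
  2 * k + d + 1 < #|nbrs E v| -> #|far_nbrs E x v| <= k ->
  exists E' X', cleaning_state E' X' /\ #|E'| < #|E|.
Proof.
case=> symE XE Xk Xcl cnt xv Dv Fk.
have /andP[vx exv] := symE _ _ xv.
have nxv : x != v by apply: contraTneq exv => ->; rewrite e_irr.
pose E' := E :\ (x, v) :\ (v, x).
have sE : E' \subset E by rewrite !(subset_trans (subsetDl _ _)).
have cE : #|E| = #|E'| + 2.
  rewrite (cardsD1 (x, v)) xv (cardsD1 (v, x) (E :\ _)) !inE vx.
  by rewrite xpair_eqE eq_sym (negbTE nxv) /= -/E' addnC -addnA addn1 addn2.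
have nX : (x, v) \notin X by apply/negP=> /XE; rewrite xv andbF.
(* If [x] and [y] were apart, every neighbour of [v] would be far from [x], far from [y], a common
   neighbour of both, or [x] itself: at most [k + k + d + 1]. The vertex [y] needs no term since
   [(y, v)] has already left [E]. *)
have key y : (y, v) \in X -> x != y -> e x y.
  move=> yX nxy; apply/negPn/negP=> nexy.
  have axy : apart x y by rewrite /apart nxy.
  have : nbrs E v \subset
      far_nbrs E x v :|: far_nbrs E y v :|: [set z | e x z && e y z] :|: [set x].
    apply/subsetP=> z vz; rewrite !inE -/(nbrs E v); move: (vz); rewrite inE => ->.
    rewrite /apart [z == x]eq_sym; have [->|nxz] := eqVneq x z; first by rewrite orbT.
    have [Ez|nyz] /= := eqVneq y z.
      move: vz; rewrite inE -Ez => /symE/andP[yv _].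
      by have /andP[_ /negP] := XE _ _ yX.
    by case: (e x z); case: (e y z).
  move/subset_leq_card; apply/negP; rewrite -ltnNge; apply: leq_ltn_trans Dv.
  apply: leq_trans (leq_card_setU _ _) _; rewrite cards1 leq_add2r.
  apply: leq_trans (leq_card_setU _ _) _; apply: leq_add (common_neighbours axy).
  by apply: leq_trans (leq_card_setU _ _) _; rewrite mul2n -addnn leq_add // Xk.
exists E', ((x, v) |: X); split; last by rewrite cE addn2 ltnS leqnSn.
split.
- move=> a b; rewrite !inE => /and3P[n1 n2 /symE/andP[-> ->]]; rewrite !andbT.
  by move: n1 n2; rewrite !xpair_eqE ![(_ == x) && _]andbC => -> ->.
- move=> a b; rewrite in_setU1 => /orP[/eqP[-> ->]|/XE/andP[-> nab]].
    by rewrite exv !inE eqxx andbF.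
  by apply: contra nab => /(subsetP sE).
- move=> a b abX; apply: leq_trans (subset_leq_card (far_nbrs_sub a b sE)) _.
  by move: abX; rewrite in_setU1 => /orP[/eqP[-> ->]|/Xk].
- move=> a b c; rewrite !in_setU1 => /orP[/eqP[-> ->]|aX] /orP[/eqP[-> Ec]|bX].
  + by rewrite eqxx in Ec.
  + exact: key.
  + by rewrite eq_sym e_sym; apply: key; rewrite -Ec.
  + exact: Xcl bX.
apply: leq_trans cnt _; rewrite cardsU1 nX cE.
by rewrite leq_add ?leq_mul ?subset_leq_card ?isolated_sub // mulnDr muln1 addnA.
Qed.

(** Each removal shrinks [E], so the process stops, and it stops only when neither kind of removal
    applies. *)
Lemma cleaning_exists : exists E X, [/\ cleaning_state E X,
  forall v, nbrs E v != set0 -> 2 * k + d + 1 < #|nbrs E v| &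
  forall x v, (x, v) \in E -> k < #|far_nbrs E x v| ].
Proof.
suff H n E X : cleaning_state E X -> #|E| < n -> exists E X, [/\ cleaning_state E X,
    forall v, nbrs E v != set0 -> 2 * k + d + 1 < #|nbrs E v| &
    forall x v, (x, v) \in E -> k < #|far_nbrs E x v| ].
  apply: (H _ [set p | e p.1 p.2] set0 _ (ltnSn _)); split.
  - by move=> x y; rewrite !inE /= e_sym => ->.
  - by move=> x v; rewrite inE.
  - by move=> x v; rewrite inE.
  - by move=> x y v; rewrite inE.
  by rewrite -addnA leq_addr.
elim: n E X => // n IH E X st lt.
have [/existsP[v /andP[Nv Dv]]|no1] :=
    boolP [exists v, (nbrs E v != set0) && (#|nbrs E v| <= 2 * k + d + 1)].
  have [E' st' lt'] := remove_vertex st Nv Dv.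
  by apply: IH st' _; apply: leq_trans lt' _.
have deg v : nbrs E v != set0 -> 2 * k + d + 1 < #|nbrs E v|.
  by move=> Nv; rewrite ltnNge; move/existsPn/(_ v): no1; rewrite Nv.
have [/existsP[[x v] /andP[/= xv Fk]]|no2] :=
    boolP [exists p, (p \in E) && (#|far_nbrs E p.1 p.2| <= k)].
  have [|E' [X' [st' lt']]] := remove_arc st xv _ Fk.
    apply: deg; apply/set0Pn; exists x; rewrite inE.
    by case: st => symE _ _ _ _; case/symE/andP: xv.
  by apply: IH st' _; apply: leq_trans lt' _.
exists E, X; split=> // x v xv; rewrite ltnNge.
by move/existsPn/(_ (x, v)): no2; rewrite xv.
Qed.

(** Continuations of a walk that has just gone from [x] to [v]. Each new vertex is only required to
    be apart from the one two steps earlier. *)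
Fixpoint far_walks E j x v : seq (seq T) :=
  if j is j'.+1 then
    [seq y :: s | y <- enum (far_nbrs E x v), s <- far_walks E j' v y]
  else [:: [::]].

Lemma far_walks_size E j x v : (forall x v, (x, v) \in E -> k < #|far_nbrs E x v|) ->
  (x, v) \in E -> k.+1 ^ j <= size (far_walks E j x v).
Proof.
move=> farE; elim: j x v => //= j IH x v xv; rewrite size_allpairs_dep sumnE big_map.
apply: leq_trans (_ : \sum_(y <- enum (far_nbrs E x v)) k.+1 ^ j <= _).
  by rewrite big_const_seq count_predT iter_addn_0 -cardE expnSr leq_mul2l farE ?orbT.
rewrite big_seq [leqRHS]big_seq; apply: leq_sum => y; rewrite mem_enum !inE => /andP[vy _].
exact: IH.
Qed.

Lemma cons_allpairs_uniq (I : seq T) (F : T -> seq (seq T)) : uniq I ->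
  (forall y, uniq (F y)) -> uniq [seq y :: s | y <- I, s <- F y].
Proof.
move=> uI uF; apply: allpairs_uniq_dep => //.
by move=> [y s] [z t] _ _ /= [-> ->].
Qed.

Lemma far_walks_uniq E j x v : uniq (far_walks E j x v).
Proof.
elim: j x v => //= j IH x v; apply: cons_allpairs_uniq => //; exact: enum_uniq.
Qed.

(** The local condition is enough: the part after [x] is induced by induction, and [ind_walk_extend]
    prepends [x]. *)
Lemma far_walks_ind E j x v s : (forall x y, (x, y) \in E -> e x y) -> j < r ->
  (x, v) \in E -> s \in far_walks E j x v -> ind_walk x (v :: s) /\ size s = j.
Proof.
move=> sE; elim: j x v s => [|j IH] x v s jr xv /=.
  by rewrite inE => /eqP->; rewrite /= sE.
case/allpairsPdep=> y [t [+ tin ->]]; rewrite mem_enum !inE => /andP[vy xy].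
have [Ht st] := IH v y t (ltnW jr) vy tin; split; last by rewrite /= st.
have A1 : all (apart x) (y :: t).
  apply: ind_walk_extend (sE _ _ xv) Ht xy _.
  by rewrite st mul2n -addnn; clear -jr r_ge2; lia.
by apply/and3P; split=> //; apply: sE.
Qed.

(** Counts induced walks of length [r] from a vertex [v0] that keeps an arc after cleaning: from
    below by the choices at each step, from above by [ind_between_bound] for each end in [A]. *)
Lemma min_degree_bound a : a \in A ->
  (forall v, v \in A -> 4 * d + 4 * k + 2 < #|[set y | e v y]|) ->
  k.+1 ^ r <= #|A| * (walk_const r * d ^ r.-1).
Proof.
move=> aA deg; have [E [X [[symE XE Xk Xcl cnt] degE farE]]] := cleaning_exists.
have cA : 0 < #|A| by apply/card_gt0P; exists a.
have sE x y : (x, y) \in E -> e x y by case/symE/andP.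
(* For fixed [v], the vertices [x] with [(x, v)] in [X] form a clique. *)
have cX : #|X| <= #|A| * d.
  suff H : atmost (fun a => a \in X) (#|A| * d).
    by rewrite cardE; apply: H (enum_uniq _) _ => b; rewrite mem_enum.
  apply: (atmost_fiber (f := @snd T T)).
  - apply: (atmost_sub _ (leqnn _) (@atmost_finset _ A)) => _ [[x v] /XE/andP[xv _] <-].
    by rewrite e_sym in xv; apply: e_A xv.
  - move=> [x v] _; apply: (@atmost_inj _ _ (@fst T T) _ (fun y => y \in [set y | (y, v) \in X])).
    + by move=> [y1 v1] [y2 v2] [_ /= ->] [_ /= ->] /= ->.
    + by move=> [y1 v1] [y1X /= E1]; rewrite inE -E1.
    apply: (@atmost_sub _ _ _ #|[set y | (y, v) \in X]| _ (fun _ H => H) _ (@atmost_finset _ _)).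
    by apply: e_clique => y z; rewrite !inE => yX zX; apply: Xcl yX zX.
have cArcs : #|A| * (4 * d + 4 * k + 3) <= #|[set p | e p.1 p.2]|.
  rewrite -sum1dep_card -(pair_big_dep xpredT (fun x y => e x y) (fun _ _ => 1)) /=.
  rewrite (bigID [in A]) /=; apply: leq_trans (leq_addr _ _).
  rewrite -sum_nat_const; apply: leq_sum => v vA; rewrite sum1dep_card addn3.
  by have := deg v vA; rewrite addn2.
have iA : #|isolated E| <= #|A|.
  by apply: subset_leq_card; apply/subsetP=> v; rewrite inE => /andP[].
(* With [E] empty there would be at most [2 * d + 2 * (2 * k + d + 1) = 4 * d + 4 * k + 2] arcs per
   vertex of [A], fewer than the degrees provide. *)
have : 0 < #|E|.
  rewrite lt0n; apply/eqP=> E0; rewrite E0 in cnt.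
  move: cA iA cX cArcs cnt; move: #|A| #|X| #|isolated E| #|[set p | e p.1 p.2]|.
  by clear; move=> *; nia.
case/card_gt0P=> -[v0 v1] v01.
(* The first step has more than [k] choices by [degE], each of the other [r - 1] by [farE]. *)
pose L := [seq y :: s | y <- enum (nbrs E v0), s <- far_walks E r.-1 v0 y].
have r1 : r.-1 < r by clear -r_ge2; lia.
have uL : uniq L.
  by apply: cons_allpairs_uniq => [|y]; [apply: enum_uniq | apply: far_walks_uniq].
have HL s : s \in L -> ind_walk v0 s /\ size s = r.
  case/allpairsPdep=> y [t [+ tin ->]]; rewrite mem_enum inE => vy.
  by have [-> /= ->] := far_walks_ind sE r1 vy tin; split=> //; clear -r_ge2; lia.
apply: leq_trans (_ : size L <= _).
  rewrite size_allpairs_dep sumnE big_map.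
  apply: leq_trans (_ : \sum_(y <- enum (nbrs E v0)) k.+1 ^ r.-1 <= _).
    rewrite big_const_seq count_predT iter_addn_0 -cardE -{1}(prednK (ltnW r_ge2)) expnSr.
    rewrite leq_mul2l; apply/orP; right.
    have : 2 * k + d + 1 < #|nbrs E v0| by apply: degE; apply/set0Pn; exists v1; rewrite inE.
    by clear; lia.
  rewrite big_seq [leqRHS]big_seq; apply: leq_sum => y; rewrite mem_enum inE => vy.
  exact: far_walks_size.
suff H : atmost (fun s => ind_walk v0 s /\ size s = r) (#|A| * (walk_const r * d ^ r.-1)).
  exact: H uL HL.
apply: (atmost_fiber (f := last v0)).
  apply: (atmost_sub _ (leqnn _) (@atmost_finset _ A)) => _ [s [Hs ss] <-].
  have := ind_walk_path Hs; case/lastP: s ss {Hs} => [ss|s w _]; first by move: r_ge2; rewrite -ss.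
  by rewrite rcons_path last_rcons => /andP[_]; rewrite e_sym; apply: e_A.
move=> s _; apply: (atmost_sub _ (leqnn _) (@ind_between_bound r r v0 (last v0 s) _ _ _)) => //.
  by move=> t [[Ht st] lt].
by clear -r_ge2; lia.
Qed.
End Cleaning.
End Graph.

(** * Cliques and degeneracy *)

Section CliqueCount.
Variables (T : finType) (e : rel T).
Implicit Types (S A : {set T}).

Definition cliqueb S := [forall x in S, forall y in S, (x != y) ==> e x y].

Lemma cliqueP S : reflect (clique e S) (cliqueb S).
Proof.
apply: (iffP 'forall_in_'forall_in_implyP) => H x; first by move=> y xS yS; apply: H.
by move=> xS y yS; apply: H.
Qed.

Definition ncliques i A := #|[set S : {set T} | [&& S \subset A, #|S| == i.+1 & cliqueb S]]|.

Lemma ncliques0 A : ncliques 0 A = #|A|.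
Proof.
rewrite -(card_imset _ (@set1_inj T)); apply: eq_card => S; rewrite inE.
apply/and3P/imsetP => [[SA /cards1P[x Sx] _]|[x xA ->]].
  by exists x; rewrite // -sub1set -Sx.
rewrite sub1set cards1; split=> //; apply/cliqueP=> y z.
by rewrite !inE => /eqP-> /eqP->; rewrite eqxx.
Qed.

Lemma ncliques_set0 i : ncliques i set0 = 0.
Proof.
by apply: eq_card0 => S; rewrite inE subset0; case: eqP => //= ->; rewrite cards0.
Qed.

(** Cliques avoiding [v] lie in [A :\ v]; deleting [v] maps the others injectively to cliques in its
    neighbourhood. *)
Lemma ncliquesS i A v : v \in A ->
  ncliques i.+1 A <= ncliques i.+1 (A :\ v) + ncliques i [set y in A | e v y].
Proof.
move=> vA; rewrite /ncliques -(cardsID [set S : {set T} | v \in S]) addnC; apply: leq_add.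
  apply: subset_leq_card; apply/subsetP=> S; rewrite !inE => /andP[vS /and3P[SA -> ->]].
  by rewrite subsetD1 SA vS.
rewrite -(card_in_imset (f := fun S : {set T} => S :\ v)); last first.
  move=> S1 S2; rewrite !inE => /andP[_ v1] /andP[_ v2] E.
  by rewrite -(setD1K v1) -(setD1K v2) E.
apply: subset_leq_card; apply/subsetP=> _ /imsetP[S + ->].
rewrite !inE => /andP[/and3P[SA cS /cliqueP cl] vS]; apply/and3P; split.
- apply/subsetP=> y; rewrite !inE => /andP[nyv yS]; rewrite (subsetP SA) //=.
  by apply: cl => //; rewrite eq_sym.
- by move: cS; rewrite (cardsD1 v) vS.
by apply/cliqueP=> x y; rewrite !inE => /andP[_ xS] /andP[_ yS]; apply: cl.
Qed.

(** Contrapositive of [min_degree_bound] for the subgraph induced on [A]; it inherits chordality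
    because its walks stay inside [A]. *)
Lemma exists_low_degree r d A k : symmetric e -> irreflexive e -> 2 <= r ->
  chordal_upto r e -> (forall S, clique e S -> #|S| <= d) -> A != set0 ->
  #|A| * (walk_const r * d ^ r.-1) < k.+1 ^ r ->
  exists2 v, v \in A & #|[set y in A | e v y]| <= 4 * d + 4 * k + 2.
Proof.
move=> e_sym e_irr r2 chord cl /set0Pn[a aA] lt.
have [/exists_inP[v vA deg]|none] :=
    boolP [exists v in A, #|[set y in A | e v y]| <= 4 * d + 4 * k + 2]; first by exists v.
pose eA : rel T := fun x y => [&& x \in A, y \in A & e x y].
have : k.+1 ^ r <= #|A| * (walk_const r * d ^ r.-1); last by rewrite leqNgt lt.
apply: (@min_degree_bound _ eA r d _ _ r2 _ _ A k _ a aA).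
- by move=> x y; rewrite /eA e_sym andbCA.
- by move=> x; rewrite /eA e_irr !andbF.
- move=> x b p /and3P[xA bA xb] pb /and3P[_ lA xl] nbl sz hp.
  have pA : {subset b :: p <= A}.
    elim: (p) b bA pb {xb xl lA nbl sz hp} => [|c q IH] b bA /=.
      by move=> _ z; rewrite inE => /eqP->.
    move=> /andP[/and3P[_ cA _] pq] z; rewrite inE => /orP[/eqP->//|].
    exact: IH.
  rewrite /eA bA lA /=; apply: (chord x b p) => //.
    by apply: (sub_path _ pb) => u v /and3P[].
  apply/allP=> y yp; have := allP hp y yp.
  by rewrite /eA xA pA ?inE ?yp ?orbT.
- by move=> S clS; apply: cl => x y xS yS /(clS x y xS yS)/and3P[].
- by move=> x y /and3P[].
move=> v vA; move/exists_inPn/(_ v vA): none; rewrite -ltnNge => /leq_trans; apply.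
by apply: subset_leq_card; apply/subsetP=> y; rewrite !inE /eA vA => /andP[-> ->].
Qed.

End CliqueCount.

(** * Real estimates *)

From Stdlib Require Import Reals Lra.

Lemma INR_addn a b : INR (addn a b) = (INR a + INR b)%R.
Proof. exact: plus_INR. Qed.

Lemma INR_muln a b : INR (muln a b) = (INR a * INR b)%R.
Proof. exact: mult_INR. Qed.

Lemma INR_expn a b : INR (expn a b) = (INR a ^ b)%R.
Proof. by elim: b => //= b IH; rewrite expnS INR_muln IH. Qed.

Lemma INR_leq a b : leq a b -> (INR a <= INR b)%R.
Proof. by move/leP; apply: le_INR. Qed.

Lemma nat_floor (X : R) : (0 <= X)%R -> exists k : nat, (INR k <= X < INR k.+1)%R.
Proof.
move=> X0; have [H1 H2] := archimed X.
have up0 : (0 < up X)%Z by apply: lt_IZR; lra.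
exists (Z.to_nat (up X - 1)); rewrite S_INR INR_IZR_INZ Znat.Z2Nat.id; last by lia.
by rewrite minus_IZR; lra.
Qed.

(** [geom_sum] adds its last term, whereas the induction on [i] multiplies the earlier exponents by
    [1/r], which requires the first term to be split off. *)
Lemma geom_sumS r i : (0 < INR r)%R -> geom_sum r i.+1 = ((1 + geom_sum r i) / INR r)%R.
Proof.
move=> r0; elim: i => [|i IH]; first by rewrite /=; field; lra.
rewrite -[LHS]/(geom_sum r i.+1 + / (INR r ^ i.+2))%R {1}IH /=.
by field; split; [apply: pow_nonzero; lra | lra].
Qed.

(** Vertices of degree at most [D] are removed one at a time, and each removal destroys at most [M]
    cliques. *)
Lemma clique_count_step (T : finType) (e : rel T) (i D : nat) (A : {set T}) (M : R) :
  (forall B : {set T}, B \subset A -> B != set0 ->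
    exists2 v, v \in B & leq #|[set y in B | e v y]| D) ->
  (forall B : {set T}, leq #|B| D -> (INR (ncliques e i B) <= M)%R) ->
  (INR (ncliques e i.+1 A) <= INR #|A| * M)%R.
Proof.
move=> deg small; suff H n (B : {set T}) : B \subset A -> #|B| = n ->
    (INR (ncliques e i.+1 B) <= INR n * M)%R.
  exact: H.
elim: n B => [|n IH] B sB cB.
  by rewrite (cards0_eq cB) ncliques_set0 /=; lra.
have [|v vB dv] := deg B sB; first by rewrite -card_gt0 cB.
apply: (Rle_trans _ _ _ (INR_leq (ncliquesS e i vB))).
rewrite INR_addn S_INR Rmult_plus_distr_r Rmult_1_l; apply: Rplus_le_compat; last exact: small.
apply: IH; first by apply: subset_trans sB; apply: subsetDl.
by move: cB; rewrite (cardsD1 v) vB => -[].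
Qed.

(** A real [x] stands for the size of [A], since neighbourhood sizes are later bounded only by real
    numbers. The bound on [d] itself restores the hypothesis [d <= x] for such a neighbourhood. *)
Lemma low_degree_real r : leq 2 r -> exists B : R, (1 <= B)%R /\
  forall (T : finType) (e : rel T) (A : {set T}) (d : nat) (x : R),
    symmetric e -> irreflexive e -> chordal_upto r e ->
    (forall S, clique e S -> leq #|S| d) ->
    (1 <= INR d <= x)%R -> (INR #|A| <= x)%R ->
    exists2 D : nat, (INR d <= B * Rpower (INR d) (1 - / INR r) * Rpower x (/ INR r) /\
      INR D <= B * Rpower (INR d) (1 - / INR r) * Rpower x (/ INR r))%R &
    forall B : {set T}, B \subset A -> B != set0 ->
      exists2 v, v \in B & leq #|[set y in B | e v y]| D.
Proof.
move=> r2; set c := INR (walk_const r).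
have c1 : (1 <= c)%R by apply: (INR_leq (walk_const_gt0 r)).
have rR : (2 <= INR r)%R by apply: (INR_leq r2).
have ir : (0 < / INR r)%R by apply: Rinv_0_lt_compat; lra.
(* From [1 <= d <= P] and [k <= c * P], the degree [4 * d + 4 * k + 2] is at most
   [4 * P + 4 * c * P + 2 * P]. *)
exists (6 + 4 * c)%R; split; first lra.
move=> T e A d x e_sym e_irr chord cl [d1 dx] Ax.
set P := (Rpower (INR d) (1 - / INR r) * Rpower x (/ INR r))%R.
have P0 : (0 < P)%R by apply: Rmult_lt_0_compat; apply: exp_pos.
have dP : (INR d <= P)%R.
  rewrite -{1}(Rpower_1 (INR d)); last lra.
  rewrite -{1}(Rplus_0_r 1) -{1}(Rplus_opp_l (/ INR r)) -Rplus_assoc Rpower_plus.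
  apply: Rmult_le_compat_l; first exact: Rlt_le (exp_pos _).
  by apply: Rle_Rpower_l; lra.
have X0 : (0 < c * P)%R by apply: Rmult_lt_0_compat; lra.
have [k [kX Xk]] := nat_floor (Rlt_le _ _ X0).
rewrite [(_ * _ * Rpower x _)%R]Rmult_assoc -/P.
have cP : (P <= c * P)%R by nra.
exists (4 * d + 4 * k + 2)%N; first split.
- by apply: (Rle_trans _ _ _ dP); nra.
- by rewrite 2!INR_addn 2!INR_muln /=; nra.
move=> B sB nB; apply: exists_low_degree (r2) _ cl nB _ => //.
rewrite ltnNge; apply/negP=> /INR_leq; rewrite !INR_muln !INR_expn -/c; apply: Rlt_not_le.
(* Since [k + 1 > c * P] and [c >= 1], the power [(k + 1)^r] exceeds [c * d^(r-1) * x], as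
   [exists_low_degree] requires. *)
have Pr : ((c * P) ^ r = c ^ r * (INR d ^ r.-1 * x))%R.
  rewrite !Rpow_mult_distr -!(Rpower_pow r (Rpower _ _)); try exact: exp_pos.
  rewrite !Rpower_mult Rinv_l ?Rpower_1; try lra.
  congr (_ * (_ * _))%R; rewrite -Rpower_pow; last lra.
  congr Rpower; rewrite Rmult_minus_distr_r Rinv_l; last lra.
  by case: (r) r2 => // r' _; rewrite S_INR /=; ring.
apply: (Rle_lt_trans _ ((c * P) ^ r)); last first.
  rewrite -!Rpower_pow //; last by apply: (lt_INR 0); lia.
  by apply: Rlt_Rpower_l; [lra | split].
have dr0 : (0 < INR d ^ r.-1)%R by apply: pow_lt; lra.
have cr : (c <= c ^ r)%R.
  rewrite -{1}(pow_1 c); apply: Rle_pow => //; apply/leP; exact: ltnW.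
have Bx : (INR #|B| <= x)%R.
  by apply: (Rle_trans _ _ _ _ Ax); apply: INR_leq; apply: subset_leq_card.
rewrite Pr (Rmult_comm (INR #|B|)) Rmult_assoc.
apply: Rmult_le_compat; try lra.
  by apply: Rmult_le_pos; [lra | apply: pos_INR].
by apply: Rmult_le_compat_l; lra.
Qed.

(** Raising [i] multiplies by [x] and puts [d^(1-1/r) * x^(1/r)] in place of [x]. With
    [g = geom_sum r i], the exponent of [x] becomes [1 + (1 + g)/r] and that of [d] becomes [i - g +
    (1 - 1/r)(1 + g) = i + 1 - (1 + g)/r]. *)
Lemma clique_count_bound r i : leq 2 r -> exists C : R, (0 <= C)%R /\
  forall (T : finType) (e : rel T) (A : {set T}) (d : nat) (x : R),
    symmetric e -> irreflexive e -> chordal_upto r e ->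
    (forall S, clique e S -> leq #|S| d) ->
    (1 <= INR d <= x)%R -> (INR #|A| <= x)%R ->
    (INR (ncliques e i A) <=
      C * Rpower (INR d) (INR i - geom_sum r i) * Rpower x (1 + geom_sum r i))%R.
Proof.
move=> r2; have rR : (2 <= INR r)%R by apply: (INR_leq r2).
elim: i => [|i [C [C0 IH]]].
  exists 1%R; split; first lra.
  move=> T e A d x _ _ _ _ [d1 dx] Ax.
  by rewrite ncliques0 /= Rminus_0_r Rplus_0_r Rpower_O ?Rpower_1; lra.
have [B [B1 low]] := low_degree_real r2.
exists (C * Rpower B (1 + geom_sum r i))%R; split.
  by apply: Rmult_le_pos => //; apply: Rlt_le; apply: exp_pos.
move=> T e A d x e_sym e_irr chord cl dx Ax.
have [D [dD DD] deg] := low T e A d x e_sym e_irr chord cl dx Ax.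
(* The induction hypothesis is applied to sets of at most [D] vertices, with the real bound on [D]
   as the new [x]. *)
have step := @clique_count_step T e i D A _ deg (fun S cS =>
  IH T e S d _ e_sym e_irr chord cl (conj (proj1 dx) dD) (Rle_trans _ _ _ (INR_leq cS) DD)).
apply: (Rle_trans _ _ _ step).
set g := geom_sum r i; rewrite geom_sumS -/g; last lra.
have Ed : Rpower (INR d) (INR i.+1 - (1 + g) / INR r) =
    (Rpower (INR d) (INR i - g) * Rpower (INR d) ((1 - / INR r) * (1 + g)))%R.
  by rewrite -Rpower_plus S_INR; congr Rpower; field; lra.
have Ex : Rpower x (1 + (1 + g) / INR r) = (x * Rpower x (/ INR r * (1 + g)))%R.
  rewrite -{2}(Rpower_1 x); last lra.
  by rewrite -Rpower_plus; congr Rpower; field; lra.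
rewrite -!Rpower_mult_distr; try exact: exp_pos; try lra; last first.
  by apply: Rmult_lt_0_compat; [lra | apply: exp_pos].
rewrite !Rpower_mult Ed Ex.
set a := Rpower B _; set b := Rpower _ (INR i - g); set b' := Rpower _ (_ * _).
set y := Rpower x _.
have M0 : (0 <= C * b * (a * b' * y))%R.
  by repeat (apply: Rmult_le_pos => //); apply: Rlt_le; apply: exp_pos.
by apply: (Rle_trans _ _ _ (Rmult_le_compat_r _ _ _ M0 Ax)); lra.
Qed.

(** * Transfer from the 1-skeleton to the complex *)

Lemma clique_card_le_dim (K : fieldType) (T : finType) (G : {set {set T}}) (r d : nat) :
  is_simplicial_complex G -> gr1_gt K G (2 * r) -> leq 2 r ->
  has_dim_pred G d -> leq 1 d -> forall S, clique (adj G) S -> leq #|S| d.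
Proof.
move=> Gc girth r2 [[F FG _] Gd] d1 S cl.
(* [T] may have points that are not vertices, so cliques of size at most 1 are covered by [1 <= d];
   larger ones consist of vertices and are faces by [skeleton_flag]. *)
have [|S1] := leqP #|S| 1; first by move/leq_trans; apply.
apply: Gd; apply: (skeleton_flag Gc girth) => //; first exact: Gc FG (sub0set _).
apply/subsetP=> x xS; have [y] : exists y, y \in S :\ x.
  by apply/card_gt0P; move: S1; rewrite (cardsD1 x) xS.
rewrite !inE => /andP[nyx yS]; have /andP[_ xyG] : adj G x y by apply: cl; rewrite // eq_sym.
by apply: Gc xyG _; rewrite sub1set !inE eqxx.
Qed.

Lemma fnum_le_ncliques (T : finType) (G : {set {set T}}) i :
  is_simplicial_complex G -> leq (fnum i G) (ncliques (adj G) i (vertices G)).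
Proof.
move=> Gc; apply: subset_leq_card; apply/subsetP=> S; rewrite !inE => /andP[SG ->] /=.
apply/andP; split; first by apply/subsetP=> x xS; rewrite inE; apply: Gc SG _; rewrite sub1set.
apply/cliqueP=> x y xS yS nxy; rewrite /adj nxy; apply: Gc SG _.
by rewrite subUset !sub1set xS.
Qed.

Theorem mainTheorem8 :
  forall (r i : nat), (2 <= r)%N ->
  exists C : R,
    forall (K : fieldType) (T : finType) (G : {set {set T}}) (d n : nat),
      is_simplicial_complex G ->
      has_dim_pred G d ->
      #|vertices G| = n ->
      gr1_gt K G (2 * r) ->
      (INR (fnum i G) <=
         C * Rpower (INR d) (INR i - geom_sum r i)
           * Rpower (INR n) (1 + geom_sum r i))%R.
Proof.
move=> r i r2; have [C [C0 H]] := clique_count_bound i r2.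
exists C => K T G d n Gc Gd Vn girth.
apply: (Rle_trans _ _ _ (INR_leq (fnum_le_ncliques i Gc))).
have [V0|[v vV]] := set_0Vmem (vertices G).
  (* Nothing is counted here, and the right side is nonnegative because [Rpower] is an exponential,
     positive even at base 0. *)
  rewrite V0 ncliques_set0.
  by repeat (apply: Rmult_le_pos => //); apply: Rlt_le; apply: exp_pos.
have [[F FG cF] Fd] := Gd.
have d1 : leq 1 d by rewrite -(cards1 v); apply: Fd; rewrite inE in vV.
have dn : leq d n.
  rewrite -cF -Vn; apply: subset_leq_card; apply/subsetP=> x xF.
  by rewrite inE; apply: Gc FG _; rewrite sub1set.
apply: H; first exact: adj_sym.
- exact: adj_irr.
- exact: skeleton_chordal Gc girth.
- exact: clique_card_le_dim Gc girth r2 Gd d1.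
- by split; [apply: (INR_leq d1) | apply: INR_leq].
by rewrite Vn; apply: Rle_refl.
Qed.
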